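(* Let $0<\mu\le 1$, $R>0$, $v_P>0$, $t_{\max}=R/v_P$, $0\le\Delta t<t_{\max}$ and $s=v_P\Delta t$. A pursuer with maximum range $R$ and speed $v_P$ launched a time $\Delta t$ in the past and its current position $P\in\mathbb{R}^2$ is known. Let the evader be at $E\in\mathbb{R}^2$ with $d=\|E-P\|>0$, and suppose $$\frac{(\mu^2-1)(R-s)^2+d^2}{2\mu d(R-s)}\in[-1,1].$$ Then the maximum cutting angle $\varphi\in[-\pi/2,\pi/2]$ (measured with respect to the normal of the line from $P$ to $E$) that is safe from the pursuer is $$\varphi_{\max}^{\mathrm{L3}}=\arcsin\left(\frac{(\mu^2-1)(R-s)^2+d^2}{2\mu d(R-s)}\right).$$
   Context: An evader and a pursuer move in the plane with constant speeds $v_E>0$ and $v_P>0$ and can change heading instantaneously; $\mu=v_E/v_P$, and throughout $\mu\le 1$. The pursuer can move for at most time $t_{\max}$ after launch, so its total range is $R=v_Pt_{\max}$. After it has been in flight for time $\Delta t$ its remaining range is $R-s$, where $s=v_P\Delta t$ ($\Delta t=0$ if it has not launched). The evader knows the pursuer's motion parameters, $\Delta t$ and its current position $P$ (''knowledge level 3''). Engagement zone (EZ): for a pursuer at position $P$ with remaining range $\rho$, and an evader with unit heading vector $u$, the EZ is the disk of radius $\rho$ centered at $P-\mu\rho\,u$. The evader at $E$ is ''inside the EZ'' if $\|E-(P-\mu\rho\,u)\|<\rho$; the boundary does not count as inside (interceptions at exactly maximum range are neglected). A heading $u$ is safe from the pursuer if the evader is not inside the EZ with $\rho=R-s$. Cutting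 angle: let $n=(E-P)/\|E-P\|$ and let $\tau$ be the unit vector obtained by rotating $n$ clockwise by $\pi/2$ (the turn direction is fixed as clockwise). The heading with cutting angle $\varphi\in[-\pi/2,\pi/2]$ is $u(\varphi)=\cos\varphi\,\tau-\sin\varphi\,n$, so $\varphi>0$ means moving closer to the pursuer. ''Maximum safe cutting angle'' means the largest $\varphi\in[-\pi/2,\pi/2]$ for which $u(\varphi)$ is safe. *)

(* Defs.v *)
From Stdlib Require Import Reals.
From Coquelicot Require Import Coquelicot.
Open Scope R_scope.

(* Coquelicot's product norm on [R * R] is the Euclidean one,
   [sqrt (|x| ^ 2 + |y| ^ 2)]. *)
Definition plane : NormedModule R_AbsRing :=
  prod_NormedModule R_AbsRing R_NormedModule R_NormedModule.

Definition rotate_cw (w : plane) : plane := (snd w, - fst w).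

(* [mu] is the speed ratio, [rho] the remaining range of the pursuer at [P],
   and [u] the evader's heading, a unit vector. *)
Definition EZ_center (mu rho : R) (P u : plane) : plane :=
  minus P (scal (mu * rho) u).

Definition inside_EZ (mu rho : R) (P E u : plane) : Prop :=
  norm (minus E (EZ_center mu rho P u)) < rho.

Definition safe_heading (mu rho : R) (P E u : plane) : Prop :=
  ~ inside_EZ mu rho P E u.

Definition line_of_sight (P E : plane) : plane :=
  scal (/ norm (minus E P)) (minus E P).

(* The heading is only meaningful, and a unit vector, when [E <> P]. *)
Definition cutting_heading (P E : plane) (phi : R) : plane :=
  let n := line_of_sight P E in
  minus (scal (cos phi) (rotate_cw n)) (scal (sin phi) n).

Definition is_max_safe_cutting_angle (mu rho : R) (P E : plane) (phi : R)
  : Prop :=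
  (- (PI / 2) <= phi <= PI / 2 /\
   safe_heading mu rho P E (cutting_heading P E phi)) /\
  forall psi : R, - (PI / 2) <= psi <= PI / 2 ->
    safe_heading mu rho P E (cutting_heading P E psi) -> psi <= phi.

(* Main.v *)
(* Let k = mu rho, with rho the remaining range.  Relative to the EZ center,
   the evader sits at (d - k sin phi) n + k cos phi tau, at squared distance
   d^2 + k^2 - 2 d k sin phi.  So the heading is safe exactly when sin phi is at
   most the argument of the arcsine, and sin is increasing on [-pi/2, pi/2]. *)
Require Import Defs.
From Stdlib Require Import Reals Lra.
From Coquelicot Require Import Coquelicot.
Open Scope R_scope.

Lemma plane_norm_sqr (w : plane) : norm w ^ 2 = fst w ^ 2 + snd w ^ 2.
Proof.
  (* Exposes the product norm, whose factors carry the norm [Rabs]. *)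
  change (sqrt (Rabs (fst w) ^ 2 + Rabs (snd w) ^ 2) ^ 2
          = fst w ^ 2 + snd w ^ 2).
  rewrite pow2_sqrt by nra.
  now rewrite !pow2_abs.
Qed.

Lemma EZ_center_distance_sqr (mu rho phi : R) (P E : plane) :
  0 < norm (minus E P) ->
  norm (minus E (EZ_center mu rho P (cutting_heading P E phi))) ^ 2
  = norm (minus E P) ^ 2 + (mu * rho) ^ 2
    - 2 * norm (minus E P) * (mu * rho) * sin phi.
Proof.
  intros Hd.
  unfold cutting_heading, line_of_sight, EZ_center.
  pose proof (plane_norm_sqr (minus E P)) as Hnorm.
  rewrite plane_norm_sqr.
  set (d := norm (minus E P)) in *; clearbody d.
  destruct P as [p1 p2], E as [e1 e2].
  unfold rotate_cw, minus, plus, opp, scal, mult in *; simpl in *.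
  unfold prod_plus, prod_opp, prod_scal, plus, opp, scal, mult in *; simpl in *.
  unfold mult in *; simpl in *.
  pose proof (sin2_cos2 phi) as Hsc; unfold Rsqr in Hsc.
  (* [(a, b)] is the line of sight n; substituting E = P + d n removes the inverse of [d]. *)
  set (a := / d * (e1 + - p1)).
  set (b := / d * (e2 + - p2)).
  assert (Hx : e1 = p1 + d * a) by (unfold a; field; lra).
  assert (Hy : e2 = p2 + d * b) by (unfold b; field; lra).
  clearbody a b; subst e1 e2.
  (* n is a unit vector: cancel [d * d] in [Hnorm]. *)
  assert (Hab : a * a + b * b = 1) by (apply Rmult_eq_reg_l with (d * d); nra).
  set (k := mu * rho); clearbody k.
  (* With |n|^2 and sin^2 + cos^2 kept as factors the expansion is a polynomial identity; both are
     then replaced by 1. *)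
  transitivity ((a * a + b * b)
    * (d * d + k * k * (sin phi * sin phi + cos phi * cos phi)
       - 2 * d * k * sin phi)); [ring | rewrite Hab, Hsc; ring].
Qed.

Lemma safe_cutting_heading_iff (mu rho phi : R) (P E : plane) :
  0 < mu -> 0 < rho -> 0 < norm (minus E P) ->
  safe_heading mu rho P E (cutting_heading P E phi) <->
  sin phi <= ((mu ^ 2 - 1) * rho ^ 2 + norm (minus E P) ^ 2)
             / (2 * mu * norm (minus E P) * rho).
Proof.
  intros Hmu Hrho Hd.
  pose proof (EZ_center_distance_sqr mu rho phi P E Hd) as Hdist.
  unfold safe_heading, inside_EZ.
  pose proof (norm_ge_0 (minus E (EZ_center mu rho P (cutting_heading P E phi))))
    as Hpos.
  set (D := norm (minus E (EZ_center _ _ _ _))) in *; clearbody D.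
  set (d := norm (minus E P)) in *; clearbody d.
  assert (Hden : 0 < 2 * mu * d * rho)
    by (repeat apply Rmult_lt_0_compat; lra).
  rewrite <- Rle_div_r by exact Hden.
  (* Both [D] and [rho] are nonnegative, so comparing them amounts to comparing their squares, and
     [Hdist] makes that linear in [sin phi]. *)
  split; intros H.
  - apply Rnot_lt_le in H; nra.
  - apply Rle_not_lt; nra.
Qed.

Theorem lemmaV1
  (vE vP mu range tmax dt s d : R) (P E : plane)
  (hvE : 0 < vE) (hvP : 0 < vP)
  (hmu : mu = vE / vP) (hmu01 : 0 < mu <= 1)
  (hrange : 0 < range) (htmax : tmax = range / vP)
  (hdt : 0 <= dt < tmax) (hs : s = vP * dt)
  (hd : d = norm (minus E P)) (hd0 : 0 < d)
  (harg : -1 <= ((mu ^ 2 - 1) * (range - s) ^ 2 + d ^ 2)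
                / (2 * mu * d * (range - s)) <= 1) :
  is_max_safe_cutting_angle mu (range - s) P E
    (asin (((mu ^ 2 - 1) * (range - s) ^ 2 + d ^ 2)
           / (2 * mu * d * (range - s)))).
Proof.
  (* The strict bound [dt < tmax] leaves some range. *)
  assert (Hrho : 0 < range - s).
  { assert (vP * dt < vP * tmax) by (apply Rmult_lt_compat_l; lra).
    assert (vP * tmax = range) by (rewrite htmax; field; lra).
    lra. }
  rewrite hd in *.
  split; [split |].
  - apply asin_bound.
  (* Equality holds here: the evader lies on the EZ boundary, which counts as safe. *)
  - apply safe_cutting_heading_iff; [lra | exact Hrho | exact hd0 |].
    rewrite sin_asin by exact harg; apply Rle_refl.
  - intros psi Hpsi Hsafe.
    apply safe_cutting_heading_iff in Hsafe; [| lra | exact Hrho | exact hd0].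
    apply sin_incr_0; try apply asin_bound; try apply Hpsi.
    now rewrite sin_asin by exact harg.
Qed.
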